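(* For any $x\in\mathbb{R}^2$ and $r>0$, $$\frac{1}{2\pi}\int_{S^1}\ln\frac{1}{|rz-x|}\,dz=\min\left\{\ln\frac1r,\ \ln\frac{1}{|x|}\right\}.$$
   Context: $S^1$ is the unit circle in $\mathbb{R}^2$ centered at the origin and $dz$ is arc length measure on $S^1$. For $x=0$ one uses the convention $\ln\frac{1}{|x|}=+\infty$, so the right-hand side is $\ln\frac1r$. *)

(* Defs.v *)
From HB Require Import structures.
From mathcomp Require Import all_boot all_order all_algebra.
From mathcomp Require Import all_classical all_reals all_analysis.
From mathcomp Require Import measurable_realfun.

Set Implicit Arguments.
Unset Strict Implicit.
Unset Printing Implicit Defensive.
Import Order.TTheory GRing.Theory Num.Theory.
Import numFieldNormedType.Exports.
Local Open Scope classical_set_scope.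
Local Open Scope ring_scope.

(* The norm that the library puts on the product [R * R] is the sup norm. *)
Definition enorm (R : realType) (x : R * R) : R :=
  Num.sqrt (x.1 ^+ 2 + x.2 ^+ 2).

Definition unit_circle (R : realType) : set (R * R) := [set z | enorm z = 1].
Arguments unit_circle : clear implicits.

Definition circle_param (R : realType) (t : R) : R * R := (cos t, sin t).

Lemma measurable_circle_param (R : realType) :
  measurable_fun [set: R] (@circle_param R).
Proof.
by apply/measurable_fun_pairP; split; apply: continuous_measurable_fun;
  [exact: continuous_cos | exact: continuous_sin].
Qed.

Definition angles (R : realType) : set R := `[0, 2 * pi[.
Arguments angles : clear implicits.

Lemma measurable_angles (R : realType) : measurable (angles R).
Proof. exact: measurable_itv. Qed.

(* Arc length on the unit circle, as a Borel measure on the plane.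
   [circle_param] has unit speed and maps [0, 2 pi[ bijectively onto the
   circle, so the arc length of [A] is the Lebesgue measure of the set of
   angles in [0, 2 pi[ that it sends into [A]. *)
Definition arc_length (R : realType) : set (R * R) -> \bar R :=
  pushforward (mrestr (@lebesgue_measure R) (@measurable_angles R))
    (@circle_param R).
Arguments arc_length : clear implicits.

HB.instance Definition _ (R : realType) :=
  Measure.copy (arc_length R)
    (measure_function_pushforward__canonical__measure_function_Measure
       (mrestr (@lebesgue_measure R) (@measurable_angles R))
       (@measurable_circle_param R)).

(* Main.v *)
Require Import Defs.
From mathcomp Require Import all_boot all_order all_algebra.
From mathcomp Require Import all_classical all_reals all_analysis.
From mathcomp Require Import measurable_realfun.
From mathcomp Require Import ring lra.
Import Order.TTheory GRing.Theory Num.Theory.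
Import numFieldNormedType.Exports.
Local Open Scope classical_set_scope.
Local Open Scope ring_scope.

(** Dividing by [r] and writing [y = r^-1 *: x], the claim is that the mean of
    [ln |e^(it) - y|] over a full turn is [ln (max 1 |y|)].

    Inside the disc ([|y| < 1]) the mean vanishes because of a doubling
    relation.  Identify the plane with the complex numbers.  From
    [(z - y) (z + y) = z^2 - y^2] with [z = e^(it)], and because adding [pi] to
    the angle changes [z] into [- z], the integral [J y] of
    [ln |e^(it) - y|^2] satisfies [2 * J y = J (y^2)]
    (lemma [int_ln_chord2_csqr]).  The integrand is bounded uniformly on each
    disc [|y| <= rho < 1], and squaring maps that disc to itself, so iterating
    gives [|J y| <= C / 2 ^ n] for every [n], hence [J y = 0]
    (lemma [int_ln_chord2_eq0]).

    Outside the disc, inversion in the unit circle gives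
    [|z - y| = |y| |z - y / |y|^2|] on the circle, which reduces to the previous
    case (lemma [log_potential_outside]).

    On the circle the integrand is unbounded.  For [|y| = 1] and [0 < rho < 1],
    [|z - rho y|^2 / rho = |z - y|^2 + (1 - rho)^2 / rho], which decreases
    to [|z - y|^2] as [rho] increases to 1.  Monotone convergence then carries
    the vanishing from the inside to the boundary (lemma [log_potential_on]). *)

(** * Integrals over a segment *)

Section folding.
Context {R : realType}.
Notation mu := (@lebesgue_measure R).

Lemma integrable_segment (f : R -> R) (a b : R) : continuous f ->
  mu.-integrable `[a, b] (EFin \o f).
Proof.
move=> cf; apply: continuous_compact_integrable; first exact: segment_compact.
exact: continuous_subspaceT.
Qed.

Lemma Rintegral_affine (f : R -> R) (c d a b : R) :
  0 < c -> a <= b -> continuous f ->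
  \int[mu]_(x in `[c * a + d, c * b + d]) f x =
  \int[mu]_(x in `[a, b]) f (c * x + d) * c.
Proof.
move=> c0 ab cf; pose F (x : R) := c * x + d.
have cF : continuous F.
  by move=> x; apply: cvgD; [exact: mulrl_continuous | exact: cvg_cst].
have dF (x : R) : is_derive x 1 F c.
  have -> : F = (cst c * id + cst d)%R by [].
  by apply: is_derive_eq; rewrite scaler0 !addr0 /GRing.scale /= mulr1.
have F' : derive1 F = cst c.
  by apply/funext => x; rewrite derive1E; apply: derive_val.
rewrite -RintegralZr//; last first.
  apply: (@integrable_segment (f \o F)) => x.
  by apply: continuous_comp; [exact: cF | exact: cf].
rewrite /Rintegral; congr fine.
rewrite (@integration_by_substitution_increasing R F f a b)//.
- by apply: eq_integral => x _; rewrite !fctE F'.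
- by move=> x y _ _ xy; rewrite /F ltrD2r ltr_pM2l.
- by rewrite F' => x _; exact: cvg_cst.
- by rewrite F'; exact: is_cvg_cst.
- by rewrite F'; exact: is_cvg_cst.
- split.
  + by move=> x _; exact: ex_derive.
  + exact/cvg_at_right_filter/cF.
  + exact/cvg_at_left_filter/cF.
- exact: continuous_subspaceT.
Qed.

(** Cutting [0, 2p] at [p] and shifting the second half onto the first turns the
    left integral into that of [t |-> g (2 t)] over [0, p], which the change of
    variable [u = 2 t] spreads over [0, 2p] again. *)
Lemma Rintegral_fold (f g : R -> R) (p : R) : 0 <= p ->
  continuous f -> continuous g ->
  (forall t, f t + f (t + p) = g (2 * t)) ->
  2 * \int[mu]_(t in `[0, 2 * p]) f t = \int[mu]_(t in `[0, 2 * p]) g t.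
Proof.
move=> p0 cf cg fg.
have cfp : continuous (fun t => f (t + p)).
  move=> x; apply: continuous_comp; last exact: cf.
  by apply: cvgD; [exact: cvg_id | exact: cvg_cst].
have -> : \int[mu]_(t in `[0, 2 * p]) f t = \int[mu]_(t in `[0, p]) g (2 * t).
  under [RHS]eq_Rintegral do rewrite -fg.
  rewrite RintegralD//; [|exact: integrable_segment..].
  have := @Rintegral_affine f 1 p 0 p ltr01 p0 cf.
  under [X in _ = X * _ -> _]eq_Rintegral do rewrite mul1r.
  rewrite mulr1 !mul1r add0r => <-.
  rewrite -(@Rintegral_itv_obnd_cbnd _ p); last first.
    apply: (integrableS _ _ _ (integrable_segment f p (p + p) cf)) => //.
    exact: subset_itv_oc_cc.
  rewrite -(@Rintegral_itvB _ f (BLeft 0) (BRight (p + p)) p) ?bnd_simp//.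
  - by rewrite mulr_natl mulr2n addrC subrK.
  - exact: integrable_segment.
  - by rewrite lerDl.
have := @Rintegral_affine g 2 0 0 p (ltr0Sn _ _) p0 cg.
under [X in _ = X * _ -> _]eq_Rintegral do rewrite addr0.
by rewrite !addr0 mulr0 => ->; rewrite mulrC.
Qed.
End folding.

(** * Chords of the unit circle and the vanishing of their mean logarithm *)

Section chord.
Context {R : realType}.
Notation mu := (@lebesgue_measure R).
Implicit Types (y : R * R) (t : R).

Definition chord2 y t : R := (cos t - y.1) ^+ 2 + (sin t - y.2) ^+ 2.

(** The square of [y] seen as a complex number. *)
Definition csqr y : R * R := (y.1 ^+ 2 - y.2 ^+ 2, 2 * (y.1 * y.2)).

Lemma enorm_ge0 y : 0 <= enorm y.
Proof. exact: sqrtr_ge0. Qed.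

Lemma sqr_enorm y : enorm y ^+ 2 = y.1 ^+ 2 + y.2 ^+ 2.
Proof. by rewrite sqr_sqrtr// addr_ge0// sqr_ge0. Qed.

Lemma enorm_eq (a : R) y :
  0 <= a -> a ^+ 2 = y.1 ^+ 2 + y.2 ^+ 2 -> enorm y = a.
Proof. by move=> a0 aE; rewrite /enorm -aE sqrtr_sqr ger0_norm. Qed.

Lemma enormZ (a : R) y : 0 <= a -> enorm (a *: y) = a * enorm y.
Proof.
move=> a0; apply: enorm_eq; first by rewrite mulr_ge0// enorm_ge0.
by rewrite exprMn sqr_enorm /= /GRing.scale /=; ring.
Qed.

Lemma enorm_csqr y : enorm (csqr y) = enorm y ^+ 2.
Proof.
apply: enorm_eq; first exact: sqr_ge0.
by rewrite sqr_enorm /=; ring.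
Qed.

Lemma enorm_circle_paramB y t :
  enorm (circle_param t - y) = Num.sqrt (chord2 y t).
Proof. by []. Qed.

Lemma chord2_ge0 y t : 0 <= chord2 y t.
Proof. by rewrite addr_ge0// sqr_ge0. Qed.

Lemma chord2E y t :
  chord2 y t = 1 + enorm y ^+ 2 - 2 * (y.1 * cos t + y.2 * sin t).
Proof. by rewrite sqr_enorm /chord2; ring: (sin2cos2 t). Qed.

(** Cauchy-Schwarz, in the form of Lagrange's identity. *)
Lemma dot_circle_le y t : `|y.1 * cos t + y.2 * sin t| <= enorm y.
Proof.
rewrite -ler_sqr ?nnegrE ?enorm_ge0// real_normK ?num_real// sqr_enorm.
have -> : y.1 ^+ 2 + y.2 ^+ 2 =
    (y.1 ^+ 2 + y.2 ^+ 2) * (cos t ^+ 2 + sin t ^+ 2).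
  by rewrite cos2Dsin2 mulr1.
rewrite -subr_ge0.
rewrite (_ : _ - _ = (y.1 * sin t - y.2 * cos t) ^+ 2) ?sqr_ge0//; ring.
Qed.

Lemma chord2_lb y t : (1 - enorm y) ^+ 2 <= chord2 y t.
Proof.
have := dot_circle_le y t; rewrite ler_norml chord2E => /andP[_ le].
by rewrite sqrrB expr1n; lra.
Qed.

Lemma chord2_ub y t : chord2 y t <= (1 + enorm y) ^+ 2.
Proof.
have := dot_circle_le y t; rewrite ler_norml chord2E => /andP[le _].
by rewrite sqrrD expr1n; lra.
Qed.

Lemma chord2_gt0 y t : enorm y < 1 -> 0 < chord2 y t.
Proof.
by move=> y1; apply: lt_le_trans (chord2_lb y t); rewrite exprn_gt0// subr_gt0.
Qed.

(** The norm of [(z - y) (z + y) = z^2 - y^2] for [z = e^(it)]: the point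
    opposite to [z] has angle [t + pi], and [z^2] has angle [2 t]. *)
Lemma chord2_double y t :
  chord2 y t * chord2 y (t + pi) = chord2 (csqr y) (2 * t).
Proof.
rewrite /chord2 cosDpi sinDpi mulr_natl cos_mulr2n sin_mulr2n /=.
rewrite (_ : cos t ^+ 2 *+ 2 - 1 = cos t ^+ 2 - sin t ^+ 2); last first.
  by ring: (sin2cos2 t).
ring.
Qed.

Lemma continuous_chord2 y : continuous (chord2 y).
Proof.
have sq (f : R -> R) (c : R) :
    continuous f -> continuous (fun t => (f t - c) ^+ 2).
  move=> cf t.
  apply: (@continuous_comp _ _ _ (fun t => f t - c) (fun x => x ^+ 2)).
    by apply: cvgB; [exact: cf | exact: cvg_cst].
  by apply: exprn_continuous.
by move=> t; apply: cvgD; apply: sq;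
  [exact: continuous_cos | exact: continuous_sin].
Qed.

Lemma continuous_ln_chord2 y :
  enorm y < 1 -> continuous (fun t => ln (chord2 y t)).
Proof.
move=> y1 t; apply: continuous_comp; first exact: continuous_chord2.
by apply: continuous_ln; exact: chord2_gt0.
Qed.

Definition int_ln_chord2 y := \int[mu]_(t in `[0, 2 * pi]) ln (chord2 y t).

Lemma int_ln_chord2_csqr y :
  enorm y < 1 -> 2 * int_ln_chord2 y = int_ln_chord2 (csqr y).
Proof.
move=> y1.
have y21 : enorm (csqr y) < 1 by rewrite enorm_csqr expr_lt1// enorm_ge0.
apply: Rintegral_fold; [exact: pi_ge0 | exact: continuous_ln_chord2.. |] => t /=.
by rewrite -chord2_double lnM// posrE chord2_gt0.
Qed.

Lemma Rintegral_angles_cst (k : R) :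
  \int[mu]_(t in `[0, 2 * pi]) k = 2 * pi * k.
Proof.
rewrite Rintegral_cst//= lebesgue_measure_itv /= lte_fin mulr_gt0 ?pi_gt0//=.
by rewrite subr0 mulrC.
Qed.

(** On the disc of radius [rho] the squared chords stay between [(1 - rho)^2]
    and [4]. *)
Lemma int_ln_chord2_bounded (rho : R) : rho < 1 ->
  exists C : R, forall y, enorm y <= rho -> `|int_ln_chord2 y| <= C.
Proof.
move=> rho1; exists (2 * pi * (ln 4 - ln ((1 - rho) ^+ 2))) => y yrho.
have y1 : enorm y < 1 by exact: le_lt_trans rho1.
have ci := continuous_ln_chord2 _ y1.
have cn : continuous (fun t => `|ln (chord2 y t)|).
  by move=> t; apply: cvg_norm; exact: ci.
apply: (le_trans (le_normr_Rintegral _ _)) => //; first exact: integrable_segment.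
rewrite -Rintegral_angles_cst; apply: le_Rintegral => //.
- exact: (integrable_segment _ _ _ cn).
- by apply: (@integrable_segment _ (fun=> _)) => ?; exact: cvg_cst.
move=> t _; have q0 := chord2_gt0 y t y1.
have rho0 : 0 < (1 - rho) ^+ 2 by rewrite exprn_gt0// subr_gt0.
have l1 : ln ((1 - rho) ^+ 2) <= ln (chord2 y t).
  rewrite ler_ln ?posrE//; apply: le_trans (chord2_lb y t).
  by rewrite ler_sqr ?nnegrE; lra.
have l2 : ln (chord2 y t) <= ln 4.
  rewrite ler_ln ?posrE//; apply: le_trans (chord2_ub y t) _.
  have := enorm_ge0 y; nra.
have l3 : ln ((1 - rho) ^+ 2) <= 0.
  by apply: ln_le0; rewrite expr_le1 ?exprn_ge0//; have := enorm_ge0 y; lra.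
have l4 : 0 <= ln 4 :> R by apply: ln_ge0; rewrite ler1n.
by rewrite ler_norml; apply/andP; split; lra.
Qed.

(** Squaring a point of the open disc does not increase its norm, so the same
    bound [C] holds along the whole orbit of [y] under [csqr], while each step
    doubles the integral. *)
Lemma int_ln_chord2_eq0 y : enorm y < 1 -> int_ln_chord2 y = 0.
Proof.
move=> y1; have [C HC] := int_ln_chord2_bounded _ y1.
have H n y' : enorm y' <= enorm y -> 2 ^+ n * `|int_ln_chord2 y'| <= C.
  elim: n y' => [|n IH] y' yy'; first by rewrite mul1r; exact: HC.
  (* one factor 2 is absorbed by passing from y' to its square *)
  rewrite exprSr -mulrA -(@ger0_norm _ 2)// -normrM.
  rewrite int_ln_chord2_csqr ?(le_lt_trans yy')//.
  rewrite ger0_norm//; apply: IH; rewrite enorm_csqr; apply: (le_trans _ yy').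
  rewrite expr2 ler_piMl ?enorm_ge0//; exact/ltW/(le_lt_trans yy').
apply/eqP; rewrite -normr_le0 leNgt; apply/negP => l0.
have := H (Num.truncn (C / `|int_ln_chord2 y|)).+1 y (lexx _).
apply/negP; rewrite -ltNge -ltr_pdivrMr//.
by apply: lt_trans (truncnS_gt _) _; rewrite -natrX ltr_nat ltn_expl.
Qed.

End chord.

Local Open Scope ereal_scope.

(** * Integration against arc length *)

Section arc_length_integral.
Context {R : realType}.
Notation mu := (@lebesgue_measure R).
Implicit Types (x y : R * R) (t : R).

(** The restricted measure agrees with [m] inside [D] and does not charge the
    complement of [D]. *)
Lemma integral_mrestr d (T : measurableType d) (m : {measure set T -> \bar R})
    (D : set T) (mD : measurable D) (f : T -> \bar R) :
  measurable_fun setT f ->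
  \int[mrestr m mD]_x f x = \int[m]_(x in D) f x.
Proof.
move=> mf; rewrite -(setUv D) integral_setU//=; first last.
- by apply/disj_setPS; rewrite setICr.
- by rewrite setUv.
- exact: measurableC.
rewrite [X in _ + X]null_set_integral ?adde0//.
- by apply: eq_measure_integral => A mA AD; rewrite /= /mrestr setIidl.
- exact: measurableC.
- exact: measurable_funTS.
- by rewrite /= /mrestr setICl measure0.
Qed.

Lemma enorm_circle_param t : enorm (circle_param t) = 1%R.
Proof. by rewrite /enorm /= cos2Dsin2 sqrtr1. Qed.

Lemma measurable_enorm : measurable_fun setT (@enorm R).
Proof.
apply: measurableT_comp; last first.
  by apply: measurable_funD; apply: measurable_funX.
apply: continuous_measurable_fun; exact: sqrt_continuous.
Qed.

Lemma measurable_unit_circle : measurable (unit_circle R).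
Proof.
rewrite (_ : unit_circle R = @enorm R @^-1` [set 1%R])// -[X in measurable X]setTI.
exact: measurable_enorm.
Qed.

(** The change of variables is made separately on the positive and the negative
    part, because integrability of the logarithmic kernel of a point of the
    circle comes only later, from the computation of its integral. *)
Lemma integral_arc_length (f : R * R -> \bar R) :
  measurable_fun setT f ->
  \int[arc_length R]_(z in unit_circle R) f z =
  \int[mu]_(t in `[0%R, (2 * pi)%R]) f (circle_param t).
Proof.
move=> mf.
have mfc : measurable_fun setT (f \o @circle_param R).
  by apply: (measurableT_comp mf); apply: measurable_circle_param.
have ST : @circle_param R @^-1` unit_circle R = setT.
  by apply/seteqP; split=> t //= _; exact: enorm_circle_param.
have P (g : R * R -> \bar R) : measurable_fun setT g -> (forall z, 0 <= g z) ->
    \int[arc_length R]_(z in unit_circle R) g z =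
    \int[mrestr mu (@measurable_angles R)]_t g (circle_param t).
  move=> mg g0; rewrite /arc_length ge0_integral_pushforward//.
  - by rewrite ST.
  - exact: measurable_circle_param.
  - exact: measurable_unit_circle.
  - exact: measurable_funTS.
rewrite integralE !P; last 4 first.
  exact: measurable_funeneg.
  by [].
  exact: measurable_funepos.
  by [].
rewrite -integral_itv_bndo_bndc; last exact: measurable_funTS.
have <- := integral_mrestr _ _ mu _ (@measurable_angles R) _ mfc.
by rewrite [RHS]integralE (funepos_comp f (@circle_param R))
  (funeneg_comp f (@circle_param R)).
Qed.
End arc_length_integral.

(** * The logarithmic potential of the unit circle *)

Section log_potential.
Context {R : realType}.
Notation mu := (@lebesgue_measure R).
Implicit Types (x y z : R * R) (t : R).

Definition log_inv (a : R) : \bar R := lne (1 / a%:E).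

Lemma log_inv0 : log_inv 0 = +oo.
Proof. by rewrite /log_inv inve0 mul1e. Qed.

Lemma log_inv_gt0 (a : R) : (0 < a)%R -> log_inv a = (- ln a)%:E.
Proof.
by move=> a0; rewrite /log_inv inver gt_eqF// mul1e lneV// lne_EFin.
Qed.

(** Here [b] may be 0, in which case both sides are [+oo]. *)
Lemma log_invM (a b : R) : (0 < a)%R -> (0 <= b)%R ->
  log_inv (a * b) = (- ln a)%:E + log_inv b.
Proof.
move=> a0; rewrite le_eqVlt => /predU1P[<-|b0].
  by rewrite mulr0 log_inv0 addey.
by rewrite !log_inv_gt0 ?mulr_gt0// lnM ?posrE// opprD.
Qed.

Lemma measurable_log_inv_enorm (g : R * R -> R * R) :
  measurable_fun setT g -> measurable_fun setT (fun z => log_inv (enorm (g z))).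
Proof.
move=> mg.
rewrite (_ : (fun z => _) =
    (fun a : R => if (a == 0)%R then +oo else (- ln a)%:E) \o @enorm R \o g);
  last first.
  apply/funext => z /=; case: eqVneq => [->|n0]; first exact: log_inv0.
  by rewrite log_inv_gt0// lt_neqAle eq_sym n0 enorm_ge0.
apply: measurableT_comp mg; apply: measurableT_comp measurable_enorm.
apply: measurable_fun_ifT => //=.
  exact: measurable_fun_eqr.
apply/measurable_EFinP; apply: measurableT_comp => //.
Qed.

Lemma measurable_affine (r : R) x :
  measurable_fun setT (fun z => (r *: z - x)%R).
Proof.
apply/measurable_fun_pairP; split.
  apply: (@measurable_funB _ _ _ _ (fun z : R * R => (r * z.1)%R) (fun=> x.1)) => //.
  by apply: measurable_funM.
apply: (@measurable_funB _ _ _ _ (fun z : R * R => (r * z.2)%R) (fun=> x.2)) => //.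
by apply: measurable_funM.
Qed.

Lemma log_inv_scale x z (r : R) : (0 < r)%R ->
  log_inv (enorm (r *: z - x)%R) =
  (- ln r)%:E + log_inv (enorm (z - r^-1 *: x)%R).
Proof.
move=> r0; rewrite -log_invM ?enorm_ge0// -enormZ ?ltW//.
by rewrite scalerBr scalerA divff ?gt_eqF// scale1r.
Qed.

Definition log_inv_chord y t : \bar R := log_inv (enorm (circle_param t - y)%R).

Lemma measurable_log_inv_chord y (D : set R) :
  measurable_fun D (log_inv_chord y).
Proof.
apply: measurable_funTS.
have m : measurable_fun setT (fun z => log_inv (enorm (z - y)%R)).
  apply: measurable_log_inv_enorm; have := measurable_affine 1 y.
  by under eq_fun do rewrite scale1r.
by apply: (measurableT_comp m); apply: measurable_circle_param.
Qed.

Lemma log_inv_chord_gt0 y t : (0 < chord2 y t)%R ->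
  log_inv_chord y t = (- (ln (chord2 y t) / 2))%:E.
Proof.
move=> q0; rewrite /log_inv_chord enorm_circle_paramB log_inv_gt0 ?sqrtr_gt0//.
congr (- _)%:E; rewrite -[in RHS](@sqr_sqrtr _ (chord2 y t)) ?ltW//.
by rewrite lnXn ?sqrtr_gt0// -[X in (X / _)%R]mulr_natr mulfK.
Qed.

(** Integrability is part of the formula because, when [|y| = 1], the integrand
    takes the value [+oo], and the additivity of the integral requires it. *)
Definition log_potential_formula y :=
  mu.-integrable `[0%R, (2 * pi)%R] (log_inv_chord y) /\
  \int[mu]_(t in `[0%R, (2 * pi)%R]) log_inv_chord y t =
    (- (2 * pi * ln (Num.max 1 (enorm y))))%:E.

Lemma log_potential_inside y : (enorm y < 1)%R -> log_potential_formula y.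
Proof.
move=> y1; have ci := continuous_ln_chord2 _ y1.
have E : log_inv_chord y = EFin \o (fun t => (- (2^-1)) * ln (chord2 y t))%R.
  by apply/funext => t; rewrite log_inv_chord_gt0 ?chord2_gt0//= mulrC mulNr.
have I : mu.-integrable `[0%R, (2 * pi)%R] (EFin \o (fun t => ln (chord2 y t))).
  exact: integrable_segment.
have J : mu.-integrable `[0%R, (2 * pi)%R] (log_inv_chord y).
  rewrite E.
  apply: (@integrable_segment _ (fun t => (- (2^-1)) * ln (chord2 y t))%R).
  by move=> t; apply: cvgM; [exact: cvg_cst | exact: ci].
split => //; rewrite max_l ?ltW// ln1 mulr0 oppr0.
rewrite -[LHS]fineK; last exact: integrable_fin_num.
congr EFin; rewrite E; transitivity ((- (2^-1)) * int_ln_chord2 y)%R.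
  exact: RintegralZl.
by rewrite int_ln_chord2_eq0// mulr0.
Qed.

(** [y / |y|^2] is the inverse of [y] with respect to the unit circle: on that
    circle, the distances to a point and to its inverse have a constant
    ratio. *)
Lemma chord2_inversion y t : (0 < enorm y)%R ->
  (chord2 y t = enorm y ^+ 2 * chord2 ((enorm y ^- 2) *: y)%R t)%R.
Proof.
move=> y0; rewrite !chord2E enormZ ?invr_ge0 ?sqr_ge0//= /GRing.scale /=.
by field; rewrite gt_eqF.
Qed.

Lemma log_inv_chord_inversion y t : (0 < enorm y)%R ->
  log_inv_chord y t =
  (- ln (enorm y))%:E + log_inv_chord ((enorm y ^- 2) *: y)%R t.
Proof.
move=> y0; rewrite /log_inv_chord !enorm_circle_paramB -log_invM ?sqrtr_ge0//.
by rewrite chord2_inversion// sqrtrM ?sqr_ge0// sqrtr_sqr ger0_norm ?enorm_ge0.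
Qed.

Lemma integral_angles_cst (k : R) :
  \int[mu]_(t in `[0%R, (2 * pi)%R]) k%:E = (2 * pi * k)%:E.
Proof.
rewrite integral_cst//= lebesgue_measure_itv /= lte_fin mulr_gt0 ?pi_gt0//=.
by rewrite oppr0 adde0 -EFinM mulrC.
Qed.

Lemma integrable_angles_cst (k : R) :
  mu.-integrable `[0%R, (2 * pi)%R] (fun=> k%:E).
Proof. by apply: (@integrable_segment _ (fun=> k)) => ?; exact: cvg_cst. Qed.

Lemma log_potential_outside y : (1 < enorm y)%R -> log_potential_formula y.
Proof.
move=> y1; have y0 : (0 < enorm y)%R by lra.
have ys : (enorm ((enorm y ^- 2) *: y)%R < 1)%R.
  rewrite enormZ ?invr_ge0 ?sqr_ge0//.
  by rewrite expr2 invfM mulfVK ?gt_eqF// invf_lt1.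
have [I J] := log_potential_inside _ ys.
have E : log_inv_chord y =
    (fun=> (- ln (enorm y))%:E) \+ log_inv_chord ((enorm y ^- 2) *: y)%R.
  by apply/funext => t; rewrite log_inv_chord_inversion.
split.
  rewrite E; apply: integrableD => //; exact: integrable_angles_cst.
rewrite E integralD//; last exact: integrable_angles_cst.
rewrite J integral_angles_cst (max_l (ltW ys)) (max_r (ltW y1)).
by rewrite ln1 mulr0 oppr0 adde0 mulrN.
Qed.

(** Starting at 1/2 rather than at 0 keeps the quotients
    [chord2 (radius n *: y) t / radius n] bounded by 5. *)
Definition radius n : R := (1 - n.+2%:R^-1)%R.

Lemma radius_ge n : (2^-1 <= radius n)%R.
Proof.
rewrite /radius lerBrDr -lerBrDl.
apply: (@le_trans _ _ 2^-1%R); last lra.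
by rewrite lef_pV2 ?posrE// ler_nat.
Qed.

Lemma radius_lt1 n : (radius n < 1)%R.
Proof. by rewrite /radius ltrBlDr ltrDl. Qed.

Lemma radius_le m n : (m <= n)%N -> (radius m <= radius n)%R.
Proof. by move=> mn; rewrite /radius lerD2l lerN2 lef_pV2 ?posrE// ler_nat. Qed.

Lemma cvg_radius : radius n @[n --> \oo] --> (1 : R)%R.
Proof.
rewrite -[X in _ --> X]subr0; apply: cvgB; first exact: cvg_cst.
have := @cvg_harmonic R; rewrite -(cvg_shiftS (@harmonic R)); exact.
Qed.

(** Dividing by [rho] makes the squared chord monotone in [rho]: the correction
    [(1 - rho) ^+ 2 / rho] decreases to 0 on ]0, 1]. *)
Lemma chord2_shrink y t (rho : R) : enorm y = 1%R -> (0 < rho)%R ->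
  (chord2 (rho *: y) t / rho = chord2 y t + (1 - rho) ^+ 2 / rho)%R.
Proof.
move=> y1 rho0; rewrite !chord2E enormZ ?ltW// y1 /= /GRing.scale /=.
by field; rewrite gt_eqF.
Qed.

(** Monotone convergence along the points [radius n *: y], which lie inside the
    disc.  The constant [K] makes the approximating functions [g n]
    nonnegative; its contribution is subtracted at the end. *)
Lemma log_potential_on y : (enorm y = 1)%R -> log_potential_formula y.
Proof.
move=> y1.
pose a n t := (chord2 y t + (1 - radius n) ^+ 2 / radius n)%R.
pose K : R := (ln 5 / 2)%R.
pose g n t := (K + - (2^-1) * ln (a n t))%R.
have rn0 n : (0 < radius n)%R by have := radius_ge n; lra.
have rn1 n := radius_lt1 n.
have aE n t : a n t = (chord2 (radius n *: y) t / radius n)%R.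
  by rewrite chord2_shrink.
have nr n : enorm (radius n *: y)%R = radius n.
  by rewrite enormZ ?ltW// y1 mulr1.
have nr1 n : (enorm (radius n *: y)%R < 1)%R by rewrite nr.
have a0 n t : (0 < a n t)%R by rewrite aE divr_gt0// chord2_gt0.
(* 5 = 4 + 1: at most 4 from the chord, at most 1 from the correction *)
have a5 n t : (a n t <= 5)%R.
  have := chord2_ub y t; rewrite y1 => c4.
  suff : ((1 - radius n) ^+ 2 / radius n <= 1)%R by rewrite /a; lra.
  rewrite ler_pdivrMr// mul1r expr2.
  have := mulr_ge0 (ltW (rn0 n)) (ltW (eqbRL (subr_gt0 _ _) (rn1 n))).
  by have := radius_ge n; have := rn1 n; lra.
have a_dec m n t : (m <= n)%N -> (a n t <= a m t)%R.
  move=> mn; rewrite lerD2l ler_pdivrMr// mulrAC ler_pdivlMr//.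
  have rmn := radius_le _ _ mn.
  rewrite ler_pM ?sqr_ge0 ?(ltW (rn0 _))//.
  rewrite ler_sqr ?nnegrE ?subr_ge0 ?(ltW (rn1 _))//.
  by rewrite lerD2l lerN2.
have a_cvg t : a n t @[n --> \oo] --> chord2 y t.
  rewrite -[X in _ --> X]addr0; apply: cvgD; first exact: cvg_cst.
  rewrite (_ : 0 = (1 - 1) ^+ 2 / 1 :> R)%R; last by rewrite subrr expr0n mul0r.
  apply: cvgM; last by apply: cvgV; [exact: oner_neq0 | exact: cvg_radius].
  rewrite expr2; under eq_cvg do rewrite expr2.
  have c : (1 - radius n)%R @[n --> \oo] --> (1 - 1 : R)%R.
    by apply: cvgB; [exact: cvg_cst | exact: cvg_radius].
  exact: cvgM.
have g0 n t : (0 <= g n t)%R.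
  have : (ln (a n t) <= ln 5)%R by rewrite ler_ln ?posrE.
  by rewrite /g /K; lra.
have g_nd t : {homo (fun n => (g n t)%:E) : n m / (n <= m)%N >-> n <= m}.
  move=> m n mn; rewrite lee_fin /g.
  have : (ln (a n t) <= ln (a m t))%R by rewrite ler_ln ?posrE// a_dec.
  lra.
have g_cvg t : (g n t)%:E @[n --> \oo] --> K%:E + log_inv_chord y t.
  have := chord2_ge0 y t; rewrite le_eqVlt => /predU1P[q0|q0].
    rewrite /log_inv_chord enorm_circle_paramB -q0 sqrtr0 log_inv0 addey//.
    apply/cvgeryP/cvgryPge => A.
    have := a_cvg t; rewrite -q0 => /cvgr_le /(_ (expR (2 * (K - A)))).
    move=> /(_ (expR_gt0 _)); apply: filterS => n.
    rewrite -{1}(@lnK _ (a n t)) ?posrE// ler_expR /g; lra.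
  rewrite log_inv_chord_gt0// -EFinD; apply: cvg_EFin; first exact: nearW.
  apply: cvgD; first exact: cvg_cst.
  rewrite mulrC -mulNr; apply: cvgM; first exact: cvg_cst.
  by apply: continuous_cvg (a_cvg t); exact: continuous_ln.
(* up to a constant, g n is the kernel of a point inside the disc *)
have gE n t : (g n t)%:E =
    (K + ln (radius n) / 2)%:E + log_inv_chord (radius n *: y)%R t.
  rewrite log_inv_chord_gt0 ?chord2_gt0// -EFinD; congr EFin.
  rewrite /g aE ln_div ?posrE ?chord2_gt0//; ring.
have g_int n : \int[mu]_(t in `[0%R, (2 * pi)%R]) (g n t)%:E =
    (2 * pi * (K + ln (radius n) / 2))%:E.
  have [I J] := log_potential_inside _ (nr1 n).
  under eq_integral do rewrite gE.
  rewrite integralD//; last exact: integrable_angles_cst.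
  by rewrite J integral_angles_cst nr max_l ?ltW// ln1 mulr0 oppr0 adde0.
have H0 t : 0 <= K%:E + log_inv_chord y t.
  rewrite -(cvg_lim _ (g_cvg t))//; apply: lime_ge.
    by apply/cvg_ex; eexists; exact: g_cvg.
  by apply: nearW => n; rewrite lee_fin.
have KI : \int[mu]_(t in `[0%R, (2 * pi)%R]) (K%:E + log_inv_chord y t) =
    (2 * pi * K)%:E.
  under eq_integral do rewrite -(cvg_lim _ (g_cvg _))//.
  rewrite (@monotone_convergence _ _ _ mu _ _ (fun n t => (g n t)%:E))//.
  - apply/cvg_lim => //; under eq_cvg do rewrite g_int.
    apply: cvg_EFin; first exact: nearW.
    apply: cvgM; first exact: cvg_cst.
    rewrite -[X in _ --> X]addr0; apply: cvgD; first exact: cvg_cst.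
    rewrite -(mul0r 2^-1%R); apply: cvgM; last exact: cvg_cst.
    rewrite -ln1; apply: continuous_cvg cvg_radius.
    exact: continuous_ln.
  - move=> n; rewrite (funext (gE n)).
    apply: emeasurable_funD => //; exact: measurable_log_inv_chord.
  - by move=> n t _; rewrite lee_fin.
have Kint : mu.-integrable `[0%R, (2 * pi)%R]
    (fun t => K%:E + log_inv_chord y t).
  apply/integrableP; split.
    apply: emeasurable_funD => //; exact: measurable_log_inv_chord.
  by under eq_integral do rewrite gee0_abs//; rewrite KI ltry.
have E : log_inv_chord y =
    (fun t => K%:E + log_inv_chord y t) \+ (fun=> (- K)%:E).
  by apply/funext => t /=; rewrite addeAC -EFinD subrr add0e.
split.
  by rewrite E; apply: integrableD => //; exact: integrable_angles_cst.
rewrite E integralD//; last exact: integrable_angles_cst.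
rewrite KI integral_angles_cst y1 maxxx ln1 -EFinD.
by congr EFin; ring.
Qed.

End log_potential.

(* On the extended reals, 1 / 0 = +oo and [lne +oo = +oo]. *)
Theorem lemma4p1 (R : realType) (x : R * R) (r : R) (r0 : (0 < r)%R) :
  ((2 * pi)^-1)%:E *
    \int[arc_length R]_(z in unit_circle R) lne (1 / (enorm (r *: z - x))%:E)
  = Order.min (lne (1 / r%:E)) (lne (1 / (enorm x)%:E)).
Proof.
rewrite integral_arc_length; last first.
  apply: measurable_log_inv_enorm.
  exact: measurable_affine.
pose y := (r^-1 *: x)%R.
have -> : \int[lebesgue_measure]_(t in `[0%R, (2 * pi)%R])
    lne (1 / (enorm (r *: circle_param t - x))%:E) =
    \int[lebesgue_measure]_(t in `[0%R, (2 * pi)%R])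
      ((- ln r)%:E + log_inv_chord y t).
  by apply: eq_integral => t _; exact: log_inv_scale.
have [I J] : log_potential_formula y.
  have [?|?|?] := ltgtP (enorm y) 1%R; [exact: log_potential_inside| |].
    exact: log_potential_outside.
  exact: log_potential_on.
rewrite integralD//; last exact: integrable_angles_cst.
rewrite J integral_angles_cst -EFinD -EFinM -!/(log_inv _) (log_inv_gt0 r)//.
have -> : ((2 * pi)^-1 *
    (2 * pi * - ln r + - (2 * pi * ln (Num.max 1 (enorm y)))) =
    - (ln r + ln (Num.max 1 (enorm y))) :> R)%R.
  by have := pi_gt0 R; move: pi => p p0; field; rewrite gt_eqF.
rewrite -lnM ?posrE// ?lt_max ?ltr01// maxr_pMr ?ltW// mulr1.
have -> : (r * enorm y = enorm x)%R.
  by rewrite enormZ ?invr_ge0 ?ltW// mulrA divff ?gt_eqF// mul1r.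
have := enorm_ge0 x; rewrite le_eqVlt => /predU1P[<-|x0].
  by rewrite max_l ?ltW// log_inv0 min_l// leey.
rewrite log_inv_gt0// -EFin_min; congr EFin.
have [rx|xr] := leP r (enorm x).
- by rewrite min_r// lerN2 ler_ln.
- by rewrite min_l// lerN2 ler_ln// ltW.
Qed.
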